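(* Let $\Omega\subset\mathbb{R}^n$ be a domain (not necessarily bounded), let $F:\mathbb{R}\times(\mathbb{R}^n\setminus\{0\})\times S^{n\times n}\to\mathbb{R}$, and let $Lu:=F(u,\nabla u,D^2u)$. Let $\delta>0$, $\Omega_\delta=\{x\in\mathbb{R}^n:\operatorname{dist}(x,\Omega)<\delta\}$ and $R_\delta=\max_{x\in\overline{\Omega_\delta}}\operatorname{dist}(x,\Omega_\delta^c)$. Suppose that for some $r>R_\delta$ there is a continuous, (strictly) increasing radial function $\phi$ defined in $B_r\setminus B_\delta$ with $\phi=0$ on $\partial B_\delta$, and that $\lambda\in\mathbb{R}$ is such that $$L\phi+\lambda\phi\le 0\quad\text{in } B_r\setminus B_\delta$$ in the viscosity sense (that is, at the points $x$ with $\delta<|x|<r$). Then $\lambda_1(\Omega)\ge\lambda$.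
   Context: $S^{n\times n}$ is the set of real symmetric $n\times n$ matrices; $B_\rho$ is the open ball of radius $\rho$ centered at the origin of $\mathbb{R}^n$; a domain is a nonempty connected open set. For a set $A$, $A^c=\mathbb{R}^n\setminus A$; $\Omega_\delta^c$ is assumed nonempty and the maximum defining $R_\delta$ is assumed to exist (in particular $R_\delta<\infty$). ''Increasing radial'' means that $\phi(x)$ depends only on $|x|$, written $\phi(x)=\phi(|x|)$, and $\phi$ is a strictly increasing function of $|x|\in[\delta,r)$. Lower semicontinuous envelope: $F_*(s,q,Y)=\liminf_{(r,p,X)\to(s,q,Y)}F(r,p,X)$, defined for $(s,q,Y)\in\mathbb{R}\times\mathbb{R}^n\times S^{n\times n}$ (including $q=0$), with values in the extended reals, the variables $(r,p,X)$ ranging over the domain of $F$, the point $(s,q,Y)$ itself being allowed when $q\neq0$. Viscosity inequality: for an open set $U\subset\mathbb{R}^n$ and a lower semicontinuous $u:U\to\mathbb{R}$, ''$Lu+\lambda u\le 0$ in $U$ in the viscosity sense'' (i.e. $u$ is a viscosity supersolution) means that for every $x\in U$ and every $\psi\in C^2$ that touches $u$ at $x$ strictly from below (i.e. $\psi(x)=u(x)$ and $\psi<u$ at all other points of a neighborhood of $x$), one has $F_*(\psi(x),\nabla\psi(x),D^2\psi(x))+\lambda\psi(x)\le 0$. Principal eigenvalue of $-L$: $$\lambda_1(\Omega)=\sup\{\lambda\in\mathbb{R}:\ \exists\, v\in C(\Omega)\text{ with } v(x)>0\ \forall x\in\Omega\text{ and } Lv+\lambda v\le 0 \text{ in }\Omega\text{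 in the viscosity sense}\}.$$ *)

(* Defs.v *)
From mathcomp Require Import all_boot all_order all_algebra.
From mathcomp Require Import all_classical all_reals all_analysis.

Set Implicit Arguments.
Unset Strict Implicit.
Unset Printing Implicit Defensive.

Import Order.TTheory GRing.Theory Num.Theory.
Import numFieldNormedType.Exports.

Local Open Scope classical_set_scope.
Local Open Scope ring_scope.

Section Euclidean.
Context {R : realType} {n : nat}.
Implicit Types (x y : 'rV[R]_n) (A : set 'rV[R]_n).

(* The library norm `|x| on 'rV[R]_n is the sup norm: it induces the usual
   topology, but distances and radial functions need the Euclidean norm. *)
Definition enorm x : R := Num.sqrt (\sum_i x 0 i ^+ 2).

(* Meaningful only for nonempty A, since inf set0 = 0 *)
Definition dist_to x A : R := inf [set enorm (x - y) | y in A].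

Definition enlargement A (delta : R) : set 'rV[R]_n :=
  [set x | dist_to x A < delta].

Definition eball (rho : R) : set 'rV[R]_n := [set x | enorm x < rho].

Definition is_domain A : Prop := [/\ A !=set0, open A & connected A].

End Euclidean.

Definition is_maximum {R : realType} (E : set R) (m : R) : Prop :=
  E m /\ ubound E m.

Section Viscosity.
Context {R : realType} {n : nat}.
Implicit Types (x : 'rV[R]_n) (U V : set 'rV[R]_n) (u psi : 'rV[R]_n -> R).

Definition partial psi (i : 'I_n) : 'rV[R]_n -> R :=
  fun x => 'D_(delta_mx 0 i) psi x.

Definition gradient psi x : 'rV[R]_n := \row_i partial psi i x.

Definition hessian psi x : 'M[R]_n :=
  \matrix_(i, j) partial (partial psi i) j x.

Definition C2_on V psi : Prop :=
  forall x, V x ->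
  [/\ {for x, continuous psi},
      forall i, derivable psi x (delta_mx 0 i) /\
                {for x, continuous (partial psi i)} &
      forall i j, derivable (partial psi i) x (delta_mx 0 j) /\
                  {for x, continuous (partial (partial psi i) j)}].

(* R x (R^n \ {0}) x S^{n x n} *)
Definition Fdomain : set (R * 'rV[R]_n * 'M[R]_n) :=
  [set z | z.1.2 != 0 /\ z.2^T = z.2].

(* F is a total function, but only its values on Fdomain are used: it stands
   for a function on Fdomain. *)
Variable F : R -> 'rV[R]_n -> 'M[R]_n -> R.

Definition F_lsc_env (s : R) (q : 'rV[R]_n) (Y : 'M[R]_n) : \bar R :=
  limf_einf (fun z : R * 'rV[R]_n * 'M[R]_n => (F z.1.1 z.1.2 z.2)%:E)
            (within Fdomain (nbhs (s, q, Y))).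

Definition touches_strictly_below psi u x : Prop :=
  psi x = u x /\ \forall y \near x, y != x -> psi y < u y.

(* "Lu + lambda u <= 0 in U in the viscosity sense", for U open and u lower
   semicontinuous on U.  The values of u outside U are irrelevant, and test
   functions are C^2 in some open neighbourhood of the touching point. *)
Definition visc_supersolution (lambda : R) U u : Prop :=
  forall x, U x -> forall V psi, open V -> V x -> C2_on V psi ->
  touches_strictly_below psi u x ->
  (F_lsc_env (psi x) (gradient psi x) (hessian psi x)
     + (lambda * psi x)%:E <= 0)%E.

Definition principal_eigenvalue (Omega : set 'rV[R]_n) : \bar R :=
  ereal_sup [set lambda%:E | lambda in [set lambda : R |
    exists v : 'rV[R]_n -> R,
      [/\ {within Omega, continuous v},
          forall x, Omega x -> 0 < v x &
          visc_supersolution lambda Omega v]]].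

End Viscosity.

Definition increasing_radial_on {R : realType} {n : nat} (delta r : R)
    (phi : 'rV[R]_n -> R) : Prop :=
  exists g : R -> R,
    (forall x, delta <= enorm x < r -> phi x = g (enorm x)) /\
    {in `[delta, r[ &, {homo g : s t / s < t}}.

(* Main.v *)
Require Import Defs.
From mathcomp Require Import all_boot all_order all_algebra.
From mathcomp Require Import all_classical all_reals all_analysis.
From mathcomp Require Import ring lra.
Import Order.TTheory GRing.Theory Num.Theory.
Import numFieldNormedType.Exports.
Local Open Scope classical_set_scope.
Local Open Scope ring_scope.

(** Let K be the complement of the delta-neighbourhood of Omega and let d(x) be
the Euclidean distance from x to K.  Writing phi(x) = g(|x|), the function
v(x) = g(d(x)), which on Omega is the infimum of phi(x - y) over the y in K with
|x - y| < r, witnesses that lambda belongs to the set whose supremum is the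
principal eigenvalue.

On Omega one has delta < d <= R_delta < r.  The strict lower bound holds because
Omega is open: a point of Omega at distance exactly delta from y in K could be
moved inside Omega closer to y ([enorm_gt_open]).  As d is continuous
([dist_to_continuous]) and g is increasing with g(delta) = 0, v is continuous
and positive on Omega.

K is closed, so d(x) = |x - y| for some y in K ([dist_to_attained]).  Since
d(z) <= |z - y| for all z, v(z) <= phi(z - y) for z near x, with equality at x.
A C^2 function psi touching v strictly from below at x therefore touches
phi(. - y) strictly from below there, that is, psi(. + y) touches phi at x - y.
As the equation does not depend on the space variable and derivatives commute
with translations, the viscosity inequality for phi at x - y is exactly the one
required of v at x. *)

(** * The Euclidean norm *)

Lemma enorm_ge0 {R : realType} {n : nat} (x : 'rV[R]_n) : 0 <= enorm x.
Proof. exact: sqrtr_ge0. Qed.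

Lemma sqr_enorm {R : realType} {n : nat} (x : 'rV[R]_n) :
  enorm x ^+ 2 = \sum_i x 0 i ^+ 2.
Proof. by rewrite sqr_sqrtr// sumr_ge0// => i _; exact: sqr_ge0. Qed.

Lemma enormZ {R : realType} {n : nat} (a : R) (x : 'rV[R]_n) :
  enorm (a *: x) = `|a| * enorm x.
Proof.
rewrite /enorm -sqrtr_sqr -sqrtrM ?sqr_ge0// mulr_sumr.
by congr Num.sqrt; apply: eq_bigr => i _; rewrite mxE exprMn.
Qed.

Lemma enormN {R : realType} {n : nat} (x : 'rV[R]_n) : enorm (- x) = enorm x.
Proof. by rewrite -scaleN1r enormZ normrN1 mul1r. Qed.

Lemma enorm0 {R : realType} {n : nat} : enorm (0 : 'rV[R]_n) = 0.
Proof. by rewrite -(scale0r 0) enormZ normr0 mul0r. Qed.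

Lemma enorm_distC {R : realType} {n : nat} (x y : 'rV[R]_n) :
  enorm (x - y) = enorm (y - x).
Proof. by rewrite -enormN opprB. Qed.

Lemma enorm_delta {R : realType} {n : nat} (i : 'I_n) :
  enorm (delta_mx 0 i : 'rV[R]_n) = 1.
Proof.
rewrite /enorm (bigD1 i)//= big1 => [|j ji]; rewrite mxE eqxx.
  by rewrite eqxx expr1n addr0 sqrtr1.
by rewrite (negPf ji) expr0n.
Qed.

Lemma enorm_eq0 {R : realType} {n : nat} {x : 'rV[R]_n} : enorm x = 0 -> x = 0.
Proof.
move=> x0; apply/rowP => i; rewrite mxE; apply/eqP; rewrite -sqrf_eq0.
have /eqP := sqr_enorm x; rewrite x0 expr0n eq_sym psumr_eq0//.
  by move=> /allP/(_ i (mem_index_enum _)).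
by move=> j _; exact: sqr_ge0.
Qed.

(** The Cauchy-Schwarz inequality, from the nonnegativity of the sum of the
squares of |y| x_i - |x| y_i. *)
Lemma sum_mul_le_enorm {R : realType} {n : nat} (x y : 'rV[R]_n) :
  \sum_i x 0 i * y 0 i <= enorm x * enorm y.
Proof.
have [->|x0] := eqVneq x 0.
  by rewrite enorm0 mul0r big1// => i _; rewrite mxE mul0r.
have [->|y0] := eqVneq y 0.
  by rewrite enorm0 mulr0 big1// => i _; rewrite mxE mulr0.
have lt0 (z : 'rV[R]_n) : z != 0 -> 0 < enorm z.
  move=> z0; rewrite lt_neqAle enorm_ge0 andbT eq_sym.
  by apply: contra z0 => /eqP/enorm_eq0/eqP.
set A := enorm x; set B := enorm y; set S := \sum_i _.
have A0 : 0 < A by exact: lt0.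
have B0 : 0 < B by exact: lt0.
have : 0 <= \sum_i (B * x 0 i - A * y 0 i) ^+ 2.
  by apply: sumr_ge0 => i _; exact: sqr_ge0.
have -> : \sum_i (B * x 0 i - A * y 0 i) ^+ 2 =
    B ^+ 2 * \sum_i x 0 i ^+ 2 + A ^+ 2 * \sum_i y 0 i ^+ 2 - 2 * (A * B) * S.
  rewrite !mulr_sumr -sumrN -!big_split /=.
  by apply: eq_bigr => i _; ring.
rewrite -!sqr_enorm -/A -/B => h.
have : 0 <= (A * B) * (A * B - S) by lra.
by rewrite pmulr_rge0 ?mulr_gt0// subr_ge0.
Qed.

Lemma ler_enormD {R : realType} {n : nat} (x y : 'rV[R]_n) :
  enorm (x + y) <= enorm x + enorm y.
Proof.
rewrite -(ler_pXn2r (n := 2))// ?nnegrE ?addr_ge0 ?enorm_ge0//.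
rewrite sqrrD !sqr_enorm.
have -> : \sum_i (x + y) 0 i ^+ 2 =
    \sum_i x 0 i ^+ 2 + 2 * (\sum_i x 0 i * y 0 i) + \sum_i y 0 i ^+ 2.
  rewrite mulr_sumr -!big_split /=.
  by apply: eq_bigr => i _; rewrite mxE; ring.
by have := sum_mul_le_enorm x y; lra.
Qed.

(** Sup-norm bounds follow from Euclidean ones, so Euclidean balls are
bounded in the sense of the topology of row vectors. *)
Lemma norm_le_enorm {R : realType} {n : nat} (x : 'rV[R]_n) : `|x| <= enorm x.
Proof.
have [/eqP x0|/mx_norm_neq0[[i j] /= e]] := boolP (mx_norm x == 0 :> R).
  rewrite [`|x|]x0.
  exact: enorm_ge0.
rewrite [`|x|]e (ord1 i) -(ler_pXn2r (n := 2))// ?nnegrE ?enorm_ge0//.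
rewrite real_normK ?num_real// sqr_enorm (bigD1 j)//= lerDl.
by apply: sumr_ge0 => k _; exact: sqr_ge0.
Qed.

Lemma enorm_continuous {R : realType} {n : nat} :
  continuous (enorm : 'rV[R]_n -> R).
Proof.
move=> x; apply: (@continuous_comp _ _ _
  (fun x : 'rV[R]_n => \sum_i x 0 i ^+ 2) Num.sqrt).
  apply: continuous_big => [|i _ {}x]; first exact: add_continuous.
  apply: (@continuous_comp _ _ _ (fun x : 'rV[R]_n => x 0 i)
    (fun t : R => t ^+ 2)).
    exact: coord_continuous.
  exact: exprn_continuous.
exact: sqrt_continuous.
Qed.

Lemma enormB_continuous {R : realType} {n : nat} (y : 'rV[R]_n) :
  continuous (fun x : 'rV[R]_n => enorm (x - y)).
Proof.
move=> x; apply: (@continuous_comp _ _ _ (fun x : 'rV[R]_n => x - y) enorm).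
  apply: (@cvgB _ _ _ (nbhs x) _ id (cst y)); first exact: cvg_id.
  exact: cvg_cst.
exact: enorm_continuous.
Qed.

(** * Distance to a set *)

Lemma dist_to_le {R : realType} {n : nat} (x : 'rV[R]_n) {y : 'rV[R]_n}
    {A : set 'rV[R]_n} :
  A y -> dist_to x A <= enorm (x - y).
Proof.
move=> Ay; apply: ge_inf; last by exists y.
by exists 0 => _ [z _ <-]; exact: enorm_ge0.
Qed.

Lemma le_dist_to {R : realType} {n : nat} (c : R) (x : 'rV[R]_n)
    (A : set 'rV[R]_n) :
  A !=set0 -> (forall y, A y -> c <= enorm (x - y)) -> c <= dist_to x A.
Proof.
move=> [a Aa] cA; apply: lb_le_inf; first by exists (enorm (x - a)), a.
by move=> _ [y Ay <-]; exact: cA.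
Qed.

Lemma dist_to_lipschitz {R : realType} {n : nat} (x z : 'rV[R]_n)
    (A : set 'rV[R]_n) :
  A !=set0 -> dist_to x A - dist_to z A <= enorm (x - z).
Proof.
move=> A0; rewrite lerBlDr -lerBlDl; apply: le_dist_to => // y Ay.
rewrite lerBlDl; apply: le_trans (dist_to_le x Ay) _.
by rewrite -[x - y](subrKA z); exact: ler_enormD.
Qed.

Lemma dist_to_continuous {R : realType} {n : nat} (A : set 'rV[R]_n) :
  A !=set0 -> continuous (dist_to ^~ A).
Proof.
move=> A0 x; apply/(@cvgrPdist_lt _ _ _ (nbhs x)) => e e0.
have c : enorm (z - x) @[z --> x] --> enorm (x - x).
  exact: enormB_continuous.
move/cvgrPdist_lt/(_ e e0) : c; rewrite subrr enorm0; apply: filterS => z /=.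
rewrite sub0r normrN ger0_norm ?enorm_ge0// => ze.
apply: le_lt_trans ze; rewrite ler_norml; apply/andP; split.
  by rewrite lerNl opprB; exact: dist_to_lipschitz.
by rewrite enorm_distC; exact: dist_to_lipschitz.
Qed.

Lemma dist_to_attained {R : realType} {n : nat} (x : 'rV[R]_n.+1)
    (A : set 'rV[R]_n.+1) :
  closed A -> A !=set0 -> exists2 y, A y & dist_to x A = enorm (x - y).
Proof.
move=> cA [a Aa].
pose f := fun y : 'rV[R]_n.+1 => enorm (y - x).
(* A minimizer over the compact part of A lying in the ball centered at x
   through a is a minimizer over A. *)
pose K := A `&` f @^-1` [set t | t <= f a].
have fK : continuous f by exact: enormB_continuous.
have cK : compact K.
  apply: bounded_closed_compact.
    exists (f a + `|x|); split; first exact: num_real.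
    move=> M /ltW leM y [_ yfa] /=; apply: le_trans leM.
    rewrite -[y](subrK x); apply: le_trans (ler_normD _ _) _.
    by rewrite lerD2r; apply: le_trans (norm_le_enorm _) _.
  apply: closedI => //; apply: preimage_closed; last exact: closed_le.
  by move=> ? _; exact: fK.
have [||y] := @compact_EVT_min _ R f K _ cK.
- by exists a; split => //=.
- exact: continuous_subspaceT.
rewrite inE => -[Ay yfa] ymin; exists y => //.
apply/eqP; rewrite eq_le dist_to_le//=; apply: le_dist_to; first by exists a.
move=> z Az; rewrite ![enorm (x - _)]enorm_distC -/(f y) -/(f z).
have [zfa|/ltW] := leP (f z) (f a); last exact: le_trans.
by apply: ymin; rewrite inE; split.
Qed.

Lemma enlargement_open {R : realType} {n : nat} (A : set 'rV[R]_n) (delta : R) :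
  A !=set0 -> open (enlargement A delta).
Proof.
move=> A0; apply: (@open_comp _ _ (dist_to ^~ A) [set t | t < delta]).
  by move=> x _; exact: dist_to_continuous.
exact: open_lt.
Qed.

Lemma sub_enlargement {R : realType} {n : nat} (A : set 'rV[R]_n) (delta : R) :
  0 < delta -> A `<=` enlargement A delta.
Proof.
move=> delta0 x Ax; apply: le_lt_trans delta0.
by rewrite -(@enorm0 R n) -(subrr x); exact: dist_to_le.
Qed.

(** A point y at distance at least delta from every point of an open set is at
distance more than delta from each of them: moving x in the open set towards y
by a small fraction t multiplies its distance to y by 1 - t. *)
Lemma enorm_gt_open {R : realType} {n : nat} {U : set 'rV[R]_n} {delta : R}
    {x y : 'rV[R]_n} :
  open U -> 0 < delta -> (forall z, U z -> delta <= enorm (z - y)) ->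
  U x -> delta < enorm (x - y).
Proof.
move=> oU delta0 Uy Ux.
have : \forall t \near (0 : R)^'+, U (x + t *: (y - x)).
  have c : (fun t : R => x + t *: (y - x)) @ (0 : R)^'+ -->
      x + 0 *: (y - x).
    apply: cvgD; first exact: cvg_cst.
    by apply: cvgZr_tmp; exact: cvg_at_right_filter.
  by rewrite scale0r addr0 in c; apply: c; exact: open_nbhs_nbhs.
move=> near_U; near (0 : R)^'+ => t.
have t0 : 0 < t by near: t; exact: nbhs_right_gt.
have t1 : t < 1 by near: t; exact: nbhs_right_lt.
have /Uy : U (x + t *: (y - x)) by near: t.
have -> : x + t *: (y - x) - y = (1 - t) *: (x - y).
  by rewrite scalerBl scale1r -(opprB x y) scalerN addrAC.
rewrite enormZ gtr0_norm ?subr_gt0// => dle.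
by have := enorm_ge0 (x - y); nra.
Unshelve. all: by end_near. Qed.

(** * Translation of test functions *)

Lemma derivable_translate {R : realType} {n : nat} (psi : 'rV[R]_n -> R)
    (y x v : 'rV[R]_n) :
  derivable psi (x + y) v -> derivable (fun z => psi (z + y)) x v.
Proof.
rewrite /derivable.
rewrite (_ : _ \o shift (x + y) = (fun z => psi (z + y)) \o shift x)//.
by apply/funext => h /=; rewrite addrA.
Qed.

Lemma partial_translate {R : realType} {n : nat} (psi : 'rV[R]_n -> R)
    (y : 'rV[R]_n) (i : 'I_n) :
  partial (fun z => psi (z + y)) i = (fun z => partial psi i (z + y)).
Proof.
apply/funext => x; rewrite /partial /derive.
rewrite (_ : _ \o shift (x + y) = (fun z => psi (z + y)) \o shift x)//.
by apply/funext => h /=; rewrite addrA.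
Qed.

Lemma gradient_translate {R : realType} {n : nat} (psi : 'rV[R]_n -> R)
    (y x : 'rV[R]_n) :
  gradient (fun z => psi (z + y)) x = gradient psi (x + y).
Proof. by apply/rowP => i; rewrite !mxE partial_translate. Qed.

Lemma hessian_translate {R : realType} {n : nat} (psi : 'rV[R]_n -> R)
    (y x : 'rV[R]_n) :
  hessian (fun z => psi (z + y)) x = hessian psi (x + y).
Proof. by apply/matrixP => i j; rewrite !mxE !partial_translate. Qed.

Lemma continuous_translate {R : realType} {n : nat} (y x : 'rV[R]_n) :
  {for x, continuous (fun z : 'rV[R]_n => z + y)}.
Proof.
rewrite /prop_for /continuous_at; apply: (@cvgD _ _ _ (nbhs x) _ id (cst y)).
  exact: cvg_id.
exact: cvg_cst.
Qed.

Lemma C2_on_translate {R : realType} {n : nat} (V : set 'rV[R]_n)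
    (psi : 'rV[R]_n -> R) (y : 'rV[R]_n) :
  C2_on V psi -> C2_on [set z | V (z + y)] (fun z => psi (z + y)).
Proof.
have cont (f : 'rV[R]_n -> R) (x : 'rV[R]_n) : {for x + y, continuous f} ->
    {for x, continuous (fun z : 'rV[R]_n => f (z + y))}.
  move=> cf; rewrite /prop_for /continuous_at.
  apply: (@continuous_comp _ _ _ (fun z : 'rV[R]_n => z + y) f) => //.
  exact: continuous_translate.
move=> C2 x /= /C2[c d1 d2]; split => [|i|i j]; rewrite ?partial_translate.
- exact: cont.
- by case: (d1 i) => ? ?; split; [exact: derivable_translate|exact: cont].
- by case: (d2 i j) => ? ?; split; [exact: derivable_translate|exact: cont].
Qed.

(** * The supersolution built from the distance function *)

Theorem theorem2p5 (R : realType) (n : nat) (Omega : set 'rV[R]_n)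
  (F : R -> 'rV[R]_n -> 'M[R]_n -> R) (delta Rdelta r lambda : R)
  (phi : 'rV[R]_n -> R)
  (hOmega : is_domain Omega)
  (hdelta : 0 < delta)
  (hcompl : ~` enlargement Omega delta !=set0)
  (hRdelta : is_maximum
     [set dist_to x (~` enlargement Omega delta)
        | x in closure (enlargement Omega delta)] Rdelta)
  (hr : Rdelta < r)
  (hphi_cont : {within eball r `\` eball delta, continuous phi})
  (hphi_rad : increasing_radial_on delta r phi)
  (hphi0 : forall x, enorm x = delta -> phi x = 0)
  (hphi : visc_supersolution F lambda
            [set x | delta < enorm x < r] phi) :
  (lambda%:E <= principal_eigenvalue F Omega)%E.
Proof.
case: n => [|n] in Omega F phi hOmega hcompl hRdelta hphi_cont hphi_rad
  hphi0 hphi *.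
  (* R^0 is a single point, so the enlargement has empty complement; for
     positive dimensions there is a unit vector. *)
  have [[x Ox] _ _] := hOmega; case: hcompl => y; case.
  by rewrite (_ : y = x); [exact: sub_enlargement|apply/rowP => -[]].
have [neOmega oOmega _] := hOmega.
pose K := ~` enlargement Omega delta; pose d x := dist_to x K.
(* The continuity of v is read off from that of phi along the ray spanned by
   the unit vector e, rather than from a continuity of g. *)
pose e : 'rV[R]_n.+1 := delta_mx 0 ord0.
have cK : closed K by apply: open_closedC; exact: enlargement_open.
have dist_att x : exists2 y, K y & d x = enorm (x - y).
  exact: dist_to_attained.
have dc : continuous d by exact: dist_to_continuous.
have d_gt x : Omega x -> delta < d x.
  move=> Ox; have [y Ky ->] := dist_att x.
  apply: (enorm_gt_open oOmega) => // z Oz; rewrite enorm_distC.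
  by apply: le_trans (dist_to_le _ Oz); rewrite leNgt; exact/negP.
have d_lt x : Omega x -> d x < r.
  move=> Ox; apply: le_lt_trans hr; apply: (hRdelta.2); exists x => //.
  by apply: subset_closure; exact: sub_enlargement.
have [x0 Ox0] := neOmega.
have delta_r : delta < r := lt_trans (d_gt _ Ox0) (d_lt _ Ox0).
have enorm_e t : 0 <= t -> enorm (t *: e) = t.
  by move=> t0; rewrite enormZ enorm_delta mulr1 ger0_norm.
have d0 x : 0 <= d x by have [y _ ->] := dist_att x; exact: enorm_ge0.
have [g [phig gmono]] := hphi_rad.
have g0 : g delta = 0.
  rewrite -(hphi0 (delta *: e)) ?phig ?enorm_e ?(ltW hdelta)//.
  by rewrite lexx.
pose v x := phi (d x *: e).
have vE x : delta <= d x < r -> v x = g (d x).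
  by move=> dx; rewrite /v phig enorm_e.
have phic z : delta < enorm z < r -> {for z, continuous phi}.
  move=> hz; pose A : set 'rV[R]_n.+1 := [set z | delta < enorm z < r].
  have oA : open A.
    rewrite (_ : A = enorm @^-1` `]delta, r[%classic).
      apply: open_comp; last exact: interval_open.
      by move=> ? _; exact: enorm_continuous.
    by apply/seteqP; split => u /=; rewrite in_itv.
  have : {within A, continuous phi}.
    apply: continuous_subspaceW hphi_cont => u /andP[u1 u2]; split => //.
    by move=> /(lt_trans u1); rewrite ltxx.
  by rewrite continuous_open_subspace// => /(_ z); apply; rewrite inE.
apply: ereal_sup_ubound; exists lambda => //; exists v; split.
- apply: continuous_in_subspaceT => x; rewrite inE => Ox.
  apply: (@continuous_comp _ _ _ (fun x => d x *: e) phi).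
    rewrite /prop_for /continuous_at.
    by apply: (@cvgZr_tmp _ _ _ (nbhs x) _ d); exact: dc.
  by apply: phic; rewrite enorm_e// d_gt// d_lt.
- move=> x Ox; rewrite vE ?(ltW (d_gt _ Ox)) ?d_lt// -g0.
  by apply: gmono; rewrite ?in_itv /= ?lexx ?delta_r ?d_gt ?d_lt// ltW ?d_gt.
- move=> x Ox V psi oV Vx C2 [psix touch].
  have [y Ky dxy] := dist_att x.
  have := hphi (x - y) _ [set z | V (z + y)] (fun z => psi (z + y)).
  rewrite gradient_translate hessian_translate subrK; apply.
  + by rewrite /= -dxy d_gt// d_lt.
  + apply: (@open_comp _ _ (fun z : 'rV[R]_n.+1 => z + y) V) => // ? _.
    exact: continuous_translate.
  + by rewrite /= subrK.
  + exact: C2_on_translate.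
  split.
    rewrite subrK psix vE ?(ltW (d_gt _ Ox)) ?d_lt//.
    by rewrite phig -dxy// ltW ?d_gt ?d_lt.
  have near_x : \forall z \near x, [/\ z != x -> psi z < v z, delta < d z &
      enorm (z - y) < r].
    have h1 : \forall z \near x, delta < d z.
      exact: (cvgr_gt _ (dc x)) (d_gt _ Ox).
    have h2 : \forall z \near x, enorm (z - y) < r.
      apply: (cvgr_lt _ (@enormB_continuous _ _ y x)).
      by rewrite -dxy d_lt.
    by near=> z; split; near: z.
  have tc : (z + y) @[z --> x - y] --> x - y + y.
    exact: continuous_translate.
  rewrite subrK in tc.
  near=> z => zx.
  have [lt_v dz zr] : [/\ z + y != x -> psi (z + y) < v (z + y),
      delta < d (z + y) & enorm (z + y - y) < r].
    by near: z; exact: tc near_x.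
  (* v (z + y) = g (d (z + y)) <= g |z| = phi z *)
  have dle : d (z + y) <= enorm z.
    by rewrite -[z in enorm z](addrK y); exact: dist_to_le.
  rewrite addrK in zr.
  apply: lt_le_trans (lt_v _) _; first by rewrite eq_sym -subr_eq eq_sym.
  rewrite vE ?(ltW dz) ?(le_lt_trans dle)//.
  rewrite phig ?zr ?andbT ?(le_trans (ltW dz))//.
  move: dle; rewrite le_eqVlt => /predU1P[-> //|dlt]; apply/ltW/gmono => //.
    by rewrite in_itv /= (ltW dz) (lt_trans dlt).
  by rewrite in_itv /= zr (le_trans (ltW dz) (ltW dlt)).
Unshelve. all: by end_near. Qed.
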